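(* Let $M\subset\mathbb{C}^9$ be the real submanifold of real codimension $5$ through $0$ given in the coordinates $(z,w)=(z_1,\dots,z_4,w_1,\dots,w_5)$ by $$\operatorname{Im} w_1= z_1\overline{z_2}+z_2\overline{z_1},\qquad \operatorname{Im} w_2=-i z_1\overline{z_2}+i z_2\overline{z_1},$$ $$\operatorname{Im} w_3= z_3\overline{z_2}+z_4\overline{z_1}+z_2\overline{z_3}+z_1\overline{z_4},\qquad \operatorname{Im} w_4=z_1\overline{z_1},\qquad \operatorname{Im} w_5=z_2\overline{z_2}.$$ Define the holomorphic vector fields $$X= i\Big(z_1\frac{\partial}{\partial z_3}+z_2\frac{\partial}{\partial z_4}\Big),\quad Y=i\Big(-i z_1\frac{\partial}{\partial z_3}+i z_2\frac{\partial}{\partial z_4}\Big),\quad Z=i z_1\frac{\partial}{\partial z_4},\quad U=i z_2\frac{\partial}{\partial z_3}.$$ Then the holomorphic vector field $$T=-\tfrac12 w_1^2\,Y+\tfrac12 w_2^2\,Y+w_1w_2\,X-2w_2w_5\,Z-2w_2w_4\,U+2w_4w_5\,Y$$ belongs to $hol(M,0)$. Hence $2$-jet determination does not hold for germs of biholomorphisms sending $M$ to $M$: there exist two distinct germs at $0$ of biholomorphic maps of $\mathbb{C}^9$ sending $M$ to $M$ that have the same $2$-jet at $0$.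
   Context: $hol(M,0)$ denotes the set of germs at $0$ of real-analytic infinitesimal CR automorphisms of $M$, i.e. germs at $0$ of holomorphic vector fields on $\mathbb{C}^9$ whose real part is tangent to $M$ along $M$. *)

(* Defs.v *)
(* MathComp-Analysis; complex numbers are R[i] for an arbitrary R : realType. *)
From HB Require Import structures.
From mathcomp Require Import all_boot all_order all_algebra.
From mathcomp Require Import complex.
From mathcomp Require Import all_classical all_reals all_analysis.

Set Implicit Arguments.
Unset Strict Implicit.
Unset Printing Implicit Defensive.

Import Order.TTheory GRing.Theory Num.Theory numFieldNormedType.Exports.

Local Open Scope classical_set_scope.
Local Open Scope ring_scope.

(* R[i] itself carries no canonical topology; packed as a numClosedFieldType
   it inherits the generic topology and normed module structure over itself, so
   that below [differentiable] and ['D_v] are complex (holomorphic) notions. *)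
Definition Cplx (R : realType) : numClosedFieldType := R[i].

Definition cofr (R : realType) (t : R) : Cplx R := real_complex R t.

(* Germs at 0 are represented by total functions; only their values near 0
   matter in the predicates below. *)

Definition same_germ (R : realType) (n : nat)
    (F G : 'rV[Cplx R]_n -> 'rV[Cplx R]_n) : Prop :=
  \forall p \near (0 : 'rV[Cplx R]_n), F p = G p.

Definition partials (R : realType) (n : nat) (s : seq 'I_n)
    (F : 'rV[Cplx R]_n -> 'rV[Cplx R]_n) : 'rV[Cplx R]_n -> 'rV[Cplx R]_n :=
  foldr (fun j G => 'D_(delta_mx 0 j : 'rV[Cplx R]_n) G) F s.

(* The k-jet at 0 is the family of all partial derivatives at 0 of order <= k
   (for germs of holomorphic maps). *)
Definition same_jet (R : realType) (n k : nat)
    (F G : 'rV[Cplx R]_n -> 'rV[Cplx R]_n) : Prop :=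
  forall s : seq 'I_n, (size s <= k)%N -> partials s F 0 = partials s G 0.

(* F is a biholomorphism, with inverse G, of an open neighbourhood U of 0 onto
   an open set V. *)
Definition biholomorphic_germ (R : realType) (n : nat)
    (F : 'rV[Cplx R]_n -> 'rV[Cplx R]_n) : Prop :=
  exists (U V : set 'rV[Cplx R]_n) (G : 'rV[Cplx R]_n -> 'rV[Cplx R]_n),
    [/\ open_nbhs (0 : 'rV[Cplx R]_n) U /\ open V,
        set_bij U V F, {in U, cancel F G},
        forall p, U p -> differentiable F p
      & forall q, V q -> differentiable G q].

Definition sends_to (R : realType) (n : nat) (M M' : set 'rV[Cplx R]_n)
    (F : 'rV[Cplx R]_n -> 'rV[Cplx R]_n) : Prop :=
  \forall p \near (0 : 'rV[Cplx R]_n), M p -> M' (F p).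

Definition jet_determination (R : realType) (n k : nat)
    (M : set 'rV[Cplx R]_n) : Prop :=
  forall F G : 'rV[Cplx R]_n -> 'rV[Cplx R]_n,
    biholomorphic_germ F -> sends_to M M F ->
    biholomorphic_germ G -> sends_to M M G ->
    same_jet k F G -> same_germ F G.

(* v is the velocity at p of a real curve contained in M.  For a real
   submanifold M these v form the real tangent space T_p M, a subspace of
   C^n = R^(2n). *)
Definition tangent_vector (R : realType) (n : nat) (M : set 'rV[Cplx R]_n)
    (p v : 'rV[Cplx R]_n) : Prop :=
  exists g : R -> 'rV[Cplx R]_n,
    [/\ g 0 = p, \forall t \near (0 : R), M (g t)
      & (cofr t)^-1 *: (g t - p) @[t --> (0 : R)^'] --> v].

(* A vector field \sum_j a_j d/dz_j is represented by its coefficients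
   (a_1, .., a_n).  Its real part (a d/dz + conj(a) d/d(conj z)) / 2 is the real
   field (Re a d/dx + Im a d/dy) / 2, that is a/2 once R^(2n) is identified
   with C^n. *)
Definition real_part (R : realType) (n : nat)
    (X : 'rV[Cplx R]_n -> 'rV[Cplx R]_n) (p : 'rV[Cplx R]_n) : 'rV[Cplx R]_n :=
  2^-1 *: X p.

Definition hol0 (R : realType) (n : nat) (M : set 'rV[Cplx R]_n)
    (X : 'rV[Cplx R]_n -> 'rV[Cplx R]_n) : Prop :=
  (\forall p \near (0 : 'rV[Cplx R]_n), differentiable X p) /\
  (\forall p \near (0 : 'rV[Cplx R]_n),
     M p -> tangent_vector M p (real_part X p)).

(* Coordinates (z_1, .., z_4, w_1, .., w_5) of C^9, with 1-based indices:
   [zc k p] is meant for 1 <= k <= 4 and [wc k p] for 1 <= k <= 5. *)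
Definition zc (R : realType) (k : nat) (p : 'rV[Cplx R]_9) : Cplx R :=
  p 0 (inord k.-1).
Definition wc (R : realType) (k : nat) (p : 'rV[Cplx R]_9) : Cplx R :=
  p 0 (inord (k + 3)).

(* The coordinate field d/dz_k. *)
Definition ddz (R : realType) (k : nat) : 'rV[Cplx R]_9 :=
  delta_mx 0 (inord k.-1).

Definition M (R : realType) : set 'rV[Cplx R]_9 :=
  [set p |
    let z1 := zc 1 p in let z2 := zc 2 p in
    let z3 := zc 3 p in let z4 := zc 4 p in
    [/\ 'Im (wc 1 p) = z1 * z2^* + z2 * z1^*,
        'Im (wc 2 p) = - 'i * z1 * z2^* + 'i * z2 * z1^*,
        'Im (wc 3 p) = z3 * z2^* + z4 * z1^* + z2 * z3^* + z1 * z4^*,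
        'Im (wc 4 p) = z1 * z1^*
      & 'Im (wc 5 p) = z2 * z2^*]].

Definition X (R : realType) (p : 'rV[Cplx R]_9) : 'rV[Cplx R]_9 :=
  'i *: (zc 1 p *: ddz R 3 + zc 2 p *: ddz R 4).

Definition Y (R : realType) (p : 'rV[Cplx R]_9) : 'rV[Cplx R]_9 :=
  'i *: ((- 'i * zc 1 p) *: ddz R 3 + ('i * zc 2 p) *: ddz R 4).

Definition Z (R : realType) (p : 'rV[Cplx R]_9) : 'rV[Cplx R]_9 :=
  ('i * zc 1 p) *: ddz R 4.

Definition U (R : realType) (p : 'rV[Cplx R]_9) : 'rV[Cplx R]_9 :=
  ('i * zc 2 p) *: ddz R 3.

Definition T (R : realType) (p : 'rV[Cplx R]_9) : 'rV[Cplx R]_9 :=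
  let w1 := wc 1 p in let w2 := wc 2 p in
  let w4 := wc 4 p in let w5 := wc 5 p in
  (- 2^-1 * w1 ^+ 2) *: Y p + (2^-1 * w2 ^+ 2) *: Y p + (w1 * w2) *: X p
  - (2 * w2 * w5) *: Z p - (2 * w2 * w4) *: U p + (2 * w4 * w5) *: Y p.

(* Main.v *)
(* T only has components along d/dz_3 and d/dz_4, with coefficients depending
   only on z_1, z_2 and w, so its flow is the polynomial shear p + t T(p), whose
   inverse is p - t T(p).  Among the equations of M only the third one involves
   z_3 or z_4, and T preserves it exactly when
     Re (T_3 conj(z_2) + T_4 conj(z_1)) = 0.
   Substituting Im w_j from the other four equations, this reduces to
   (Im w_1)^2 + (Im w_2)^2 = 4 Im w_4 Im w_5, which holds since both sides are
   4 |z_1 z_2|^2.  Finally T vanishes to order 3 at 0, so the time-one shear has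
   the 2-jet of the identity without being the identity. *)

Require Import Defs.
From mathcomp Require Import all_boot all_order all_algebra.
From mathcomp Require Import all_classical all_reals all_analysis.
From mathcomp Require Import complex ring zify.

Set Implicit Arguments.
Unset Strict Implicit.
Unset Printing Implicit Defensive.

Import Order.TTheory GRing.Theory Num.Theory numFieldNormedType.Exports.

Local Open Scope classical_set_scope.
Local Open Scope ring_scope.

(** * Polynomial maps and their vanishing order at 0 *)

(* Only a lower bound for the vanishing order is recorded: [vanish_le] allows k
   to drop, so order 0 means an arbitrary polynomial. *)
Inductive poly_vanishing (K : numFieldType) (n : nat) :
    nat -> ('rV[K]_n -> K) -> Prop :=
| vanish_cst c : poly_vanishing 0 (fun=> c)
| vanish_coord i : poly_vanishing 1 (fun p => p 0 i)
| vanishD k f g : poly_vanishing k f -> poly_vanishing k g ->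
    poly_vanishing k (fun p => f p + g p)
| vanishM k l f g : poly_vanishing k f -> poly_vanishing l g ->
    poly_vanishing (k + l) (fun p => f p * g p)
| vanish_le k l f : (l <= k)%N -> poly_vanishing k f -> poly_vanishing l f.

Arguments vanish_cst {K n} c.
Arguments vanish_coord {K n} i.

Section PolyMaps.
Context {K : numFieldType} {n : nat}.
Implicit Types (f : 'rV[K]_n -> K) (F G : 'rV[K]_n -> 'rV[K]_n).

Lemma derive_coord F p v i : derivable F p v ->
  'D_v (fun q => F q 0 i) p = ('D_v F p) 0 i.
Proof.
move=> dF; apply/cvg_lim => //=.
rewrite (_ : (fun h => _) = fun h => (h^-1 *: (F (h *: v + p) - F p)) 0 i).
  exact: (cvg_comp _ _ dF (@coord_continuous _ _ _ 0 i _)).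
by apply/funext => h; rewrite !mxE.
Qed.

Lemma vanish_eq0 k f : poly_vanishing k f -> (0 < k)%N -> f 0 = 0.
Proof.
elim=> [c|i|{}k {}f g _ IHf _ IHg k0|{}k l {}f g _ IHf _ IHg|
  {}k l {}f lk _ IHf l0] //.
- by rewrite mxE.
- by rewrite IHf // IHg // addr0.
- by rewrite addn_gt0 => /orP[/IHf ->|/IHg ->]; rewrite ?mul0r ?mulr0.
- by rewrite IHf // (leq_trans l0).
Qed.

Lemma poly_differentiable k f p : poly_vanishing k f -> differentiable f p.
Proof.
elim=> [c|i|{}k {}f g _ IHf _ IHg|{}k l {}f g _ IHf _ IHg|//].
- exact: differentiable_cst.
- exact: differentiable_coord.
- exact: differentiableD.
- exact: differentiableM.
Qed.

(** Induction by the product rule; for a constant the truncated order [0.-1 = 0] is right, its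
    derivative being the constant 0. *)
Lemma poly_derive k f v : poly_vanishing k f -> poly_vanishing k.-1 ('D_v f).
Proof.
have der l g p : poly_vanishing l g -> derivable g p v.
  by move=> /poly_differentiable gl; exact: diff_derivable.
elim=> [c|i|{}k {}f g fk IHf gk IHg|{}k l {}f g fk IHf gl IHg|
  {}k l {}f lk _ IHf].
- rewrite (_ : 'D_v _ = fun=> 0); first exact: vanish_cst.
  by apply/funext => p; exact: derive_cst.
- rewrite (_ : 'D_v _ = fun=> v 0 i); first exact: vanish_cst.
  by apply/funext => p; rewrite (@derive_coord id) ?derive_id.
- rewrite (_ : 'D_v _ = fun p => 'D_v f p + 'D_v g p); first exact: vanishD.
  by apply/funext => p; apply: deriveD; [exact: der fk|exact: der gk].
- rewrite (_ : 'D_v _ = fun p => f p * 'D_v g p + g p * 'D_v f p).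
    apply: vanishD; [apply: vanish_le (vanishM fk IHg)|
                     apply: vanish_le (vanishM gl IHf)].
      (* If [l = 0], the predecessor truncates and the order [k] obtained exceeds the required
         [k.-1]; [vanish_le] absorbs this. *)
      by case: l {gl IHg} => [|l]; rewrite ?addnS ?addn0 ?leq_pred.
    by case: k {fk IHf} => [|k];
      rewrite ?addn0 ?add0n ?addSn ?leq_pred ?[(l + k)%N]addnC.
  by apply/funext => p; apply: deriveM; [exact: der fk|exact: der gl].
- by apply: vanish_le IHf; rewrite -!subn1 leq_sub2r.
Qed.

Definition poly_map_vanishing k F :=
  forall j, poly_vanishing k (fun p => F p 0 j).

Lemma poly_map_vanish_eq0 k F : poly_map_vanishing k.+1 F -> F 0 = 0.
Proof. by move=> Fk; apply/rowP => j; rewrite mxE (vanish_eq0 (Fk j)). Qed.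

Lemma poly_map_id : poly_map_vanishing 1 (@id 'rV[K]_n).
Proof. by move=> j; exact: vanish_coord. Qed.

Lemma poly_map_differentiable k F p :
  poly_map_vanishing k F -> differentiable F p.
Proof.
move=> Fk; rewrite (_ : F = \sum_j (fun q => F q 0 j *: delta_mx 0 j)).
  apply: differentiable_sum => j; apply: differentiableZl.
  exact: poly_differentiable (Fk j).
by apply/funext => q; rewrite fct_sumE -row_sum_delta.
Qed.

Lemma poly_map_derive k F v :
  poly_map_vanishing k F -> poly_map_vanishing k.-1 ('D_v F).
Proof.
move=> Fk j; rewrite (_ : (fun _ => _) = 'D_v (fun p => F p 0 j)).
  exact: poly_derive.
apply/funext => p; rewrite derive_coord //.
exact/diff_derivable/(poly_map_differentiable _ Fk).
Qed.

End PolyMaps.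

(** * Jets of polynomial maps *)

Lemma poly_map_partials (R : realType) (n : nat) k (s : seq 'I_n)
    (F : 'rV[Cplx R]_n -> 'rV[Cplx R]_n) :
  poly_map_vanishing k F -> poly_map_vanishing (k - size s) (partials s F).
Proof.
move=> Fk; elim: s => [|j s IHs] /=; first by rewrite subn0.
by rewrite subnS; exact: poly_map_derive.
Qed.

Lemma partialsD (R : realType) (n : nat) (s : seq 'I_n) k l
    (F G : 'rV[Cplx R]_n -> 'rV[Cplx R]_n) :
  poly_map_vanishing k F -> poly_map_vanishing l G ->
  partials s (F + G) = partials s F + partials s G.
Proof.
move=> Fk Gl; elim: s => //= j s ->; apply/funext => p; apply: deriveD.
  exact/diff_derivable/(poly_map_differentiable _ (poly_map_partials s Fk)).
exact/diff_derivable/(poly_map_differentiable _ (poly_map_partials s Gl)).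
Qed.

(** At most [k] derivatives of [G] leave vanishing order at least 1, so they contribute nothing at
    0. *)
Lemma same_jet_addr (R : realType) (n k l : nat)
    (F G : 'rV[Cplx R]_n -> 'rV[Cplx R]_n) :
  poly_map_vanishing l F -> poly_map_vanishing k.+1 G ->
  same_jet k (F + G) F.
Proof.
move=> Fl Gk s sk; rewrite (partialsD s Fl Gk) /GRing.add /=.
have := poly_map_partials s Gk; rewrite subSn // => /poly_map_vanish_eq0 ->.
exact: addr0.
Qed.

(** * The shear along [T] *)

(** [T3] and [T4] are the components of [T] along d/dz_3 and d/dz_4, expanded into scalar multiples
    of cubic monomials to fit [monomial_vanish]. *)
Definition T3 (R : realType) (p : 'rV[Cplx R]_9) : Cplx R :=
  - 2^-1 * (wc 1 p * wc 1 p * zc 1 p) + 2^-1 * (wc 2 p * wc 2 p * zc 1 p)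
  + 2 * (wc 4 p * wc 5 p * zc 1 p) + 'i * (wc 1 p * wc 2 p * zc 1 p)
  + (- 2 * 'i) * (wc 2 p * wc 4 p * zc 2 p).

Definition T4 (R : realType) (p : 'rV[Cplx R]_9) : Cplx R :=
  2^-1 * (wc 1 p * wc 1 p * zc 2 p) + (- 2^-1) * (wc 2 p * wc 2 p * zc 2 p)
  + (- 2) * (wc 4 p * wc 5 p * zc 2 p) + 'i * (wc 1 p * wc 2 p * zc 2 p)
  + (- 2 * 'i) * (wc 2 p * wc 5 p * zc 1 p).

Section ShearAlongT.
Context (R : realType).
Implicit Types (p : 'rV[Cplx R]_9).

Lemma TE p : T p = T3 p *: ddz R 3 + T4 p *: ddz R 4.
Proof.
have ii : 'i * 'i = -1 :> Cplx R by rewrite -expr2 sqrCi.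
rewrite /T /X /Y /Z /U /T3 /T4; move: (ddz R 3) (ddz R 4) => d3 d4.
move: (wc 1 p) (wc 2 p) (wc 4 p) (wc 5 p) (zc 1 p) (zc 2 p) d3 d4 'i ii.
move: (Cplx R) => C w1 w2 w4 w5 z1 z2 d3 d4 i ii.
apply/rowP => j; rewrite !mxE.
by ring: ii.
Qed.

Lemma monomial_vanish (c : Cplx R) (i j k : 'I_9) :
  poly_vanishing 3 (fun p => c * (p 0 i * p 0 j * p 0 k)).
Proof.
exact: (vanishM (vanish_cst c)
  (vanishM (vanishM (vanish_coord i) (vanish_coord j)) (vanish_coord k))).
Qed.

Lemma T_vanish : poly_map_vanishing 3 (@T R).
Proof.
move=> j; rewrite (_ : (fun _ => _) =
    fun p => T3 p * ddz R 3 0 j + T4 p * ddz R 4 0 j).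
  apply: vanishD; apply: (vanishM (k := 3) (l := 0)); try exact: vanish_cst;
    by do !apply: vanishD; exact: monomial_vanish.
by apply/funext => p; rewrite TE !mxE.
Qed.

Lemma zc_shear k p (a b : Cplx R) : (0 < k <= 2)%N ->
  zc k (p + (a *: ddz R 3 + b *: ddz R 4)) = zc k p.
Proof.
move=> /andP[]; case: k => [|[|[|]]] // _ _.
all: by rewrite /zc !mxE -!val_eqE /= !inordK // !mulr0 !addr0.
Qed.

Lemma zc3_shear p (a b : Cplx R) :
  zc 3 (p + (a *: ddz R 3 + b *: ddz R 4)) = zc 3 p + a.
Proof. by rewrite /zc !mxE -!val_eqE /= !inordK //= mulr1 mulr0 addr0. Qed.

Lemma zc4_shear p (a b : Cplx R) :
  zc 4 (p + (a *: ddz R 3 + b *: ddz R 4)) = zc 4 p + b.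
Proof. by rewrite /zc !mxE -!val_eqE /= !inordK //= mulr1 mulr0 add0r. Qed.

Lemma wc_shear k p (a b : Cplx R) : (0 < k <= 5)%N ->
  wc k (p + (a *: ddz R 3 + b *: ddz R 4)) = wc k p.
Proof.
move=> /andP[k0 k5].
rewrite /wc !mxE -!val_eqE /= !inordK ?addn3 ?ltnS //=.
(* The index [k + 3] is at least 4, past the positions 2 and 3 of z_3 and z_4. *)
rewrite ![_ == _]gtn_eqF ?mulr0 ?addr0 //; lia.
Qed.

Definition shearE := (zc3_shear, zc4_shear, zc_shear, wc_shear).

Lemma T_scale p t : t *: T p = (t * T3 p) *: ddz R 3 + (t * T4 p) *: ddz R 4.
Proof. by rewrite TE scalerDr !scalerA. Qed.

Lemma T_shear p t : T (p + t *: T p) = T p.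
Proof. by rewrite T_scale [in LHS]TE /T3 /T4 !shearE // -TE. Qed.

(** On [M] this eliminates the conjugates of the w_j, turning tangency into an algebraic identity in
    w, z and the conjugates of z. *)
Lemma im_conj (w v : Cplx R) : 'Im w = v -> w^* = w - 2 * 'i * v.
Proof.
move=> <-; rewrite [in LHS](Crect w) [X in _ = X - _](Crect w).
rewrite rmorphD rmorphM /= conjCi !conj_Creal ?Creal_Re ?Creal_Im //.
by ring.
Qed.

Lemma T_tangent p : M p ->
  T3 p * (zc 2 p)^* + T4 p * (zc 1 p)^* + zc 2 p * (T3 p)^* + zc 1 p * (T4 p)^*
  = 0.
Proof.
have ii : 'i * 'i = -1 :> Cplx R by rewrite -expr2 sqrCi.
case=> /im_conj w1 /im_conj w2 _ /im_conj w4 /im_conj w5.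
rewrite /T3 /T4 !(rmorphD, rmorphM, rmorphN) /=.
rewrite !(fmorphV, rmorph_nat, rmorph1, conjCi).
rewrite w1 w2 w4 w5.
by field: ii.
Qed.

Lemma M_shear p t : t^* = t -> M p -> M (p + t *: T p).
Proof.
move=> tr Mp; have T0 := T_tangent Mp.
rewrite T_scale; case: Mp => M1 M2 M3 M4 M5.
split; rewrite !shearE //.
rewrite M3 !rmorphD !rmorphM /= tr.
(* As [t] is real, the right-hand side of the third equation grows by exactly [t] times the
   expression of [T_tangent]. *)
apply/eqP; rewrite -subr_eq0; apply/eqP; rewrite -[RHS](mulr0 (-t)) -T0.
by ring.
Qed.

Lemma shear_biholomorphic : biholomorphic_germ (id + @T R).
Proof.
have TK p : (id + @T R) ((id - @T R) p) = p.
  have := T_shear p (-1); rewrite scaleN1r => Tp.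
  by rewrite !fctE /= Tp subrK.
have KT p : (id - @T R) ((id + @T R) p) = p.
  have := T_shear p 1; rewrite scale1r => Tp.
  by rewrite !fctE /= Tp addrK.
exists setT, setT, (id - @T R); split.
- by split; [split; [exact: openT|]|exact: openT].
- split; [by move=> p|by move=> p q _ _ pq; rewrite -(KT p) -(KT q) pq|].
  by move=> p _; exists ((id - @T R) p); [|exact: TK].
- by move=> p _; exact: KT.
- move=> p _; apply: differentiableD; apply: poly_map_differentiable.
    exact: poly_map_id.
  exact: T_vanish.
- move=> p _; apply: differentiableB; apply: poly_map_differentiable.
    exact: poly_map_id.
  exact: T_vanish.
Qed.

Lemma id_biholomorphic : biholomorphic_germ (@id 'rV[Cplx R]_9).
Proof.
exists setT, setT, id; split.
- by split; [split; [exact: openT|]|exact: openT].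
- by split=> [p|p q|p _] //; exists p.
- by move=> p _.
- by move=> p _; exact: poly_map_differentiable poly_map_id.
- by move=> p _; exact: poly_map_differentiable poly_map_id.
Qed.

(** The diagonal supplies points arbitrarily close to 0 where [T] does not vanish. *)
Lemma T3_diag (t : Cplx R) : T3 (t *: const_mx 1) = (2 - 'i) * t ^+ 3.
Proof. by rewrite /T3 /zc /wc !mxE; field. Qed.

Lemma shear_neq_id : ~ same_germ (id + @T R) id.
Proof.
move=> T0.
have := @scalel_continuous _ _ (const_mx 1 : 'rV[Cplx R]_9) 0.
rewrite /continuous_at scale0r => diag0.
have /nbhs_ballP[e /= e0 He] := diag0 _ T0.
(* The radius [e] is itself a positive element of [Cplx R], so [e / 2] is a nonzero scalar inside
   the ball. *)
have : (id + @T R) ((e / 2) *: const_mx 1) = (e / 2) *: const_mx 1.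
  apply: He; rewrite /ball /= sub0r normrN gtr0_norm ?divr_gt0 //.
  by rewrite gtr_pMr // invf_lt1 // ltr1n.
rewrite fctE TE /= => /(congr1 (zc 3)); rewrite !shearE T3_diag.
move=> /eqP; rewrite -[eqbRHS]addr0 (inj_eq (addrI _)) mulf_eq0 expf_eq0 /=.
rewrite (gt_eqF (divr_gt0 e0 _)) // orbF subr_eq0 => /eqP i2.
(* Vanishing of [2 - 'i] would give 4 = -1, that is 5 = 0, against characteristic 0. *)
have := sqrCi (Cplx R); rewrite -i2 => /eqP; rewrite -natrX -subr_eq0 opprK.
by rewrite natr1 pnatr_eq0.
Qed.

Lemma T_hol0 : hol0 (@M R) (@T R).
Proof.
split; near=> p; first exact: poly_map_differentiable T_vanish.
(* The real line through [p] with velocity [T p / 2] stays in [M] by [M_shear] with the real factor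
   [t / 2]. *)
move=> Mp; exists (fun t => p + cofr t *: real_part (@T R) p).
have cofr_real (t : R) : (cofr t * 2^-1)^* = cofr t * 2^-1.
  rewrite rmorphM /= fmorphV rmorph_nat conj_Creal //.
  by apply/complex_realP; exists t.
split.
- by rewrite /cofr rmorph0 scale0r addr0.
- near=> t; rewrite /real_part scalerA; exact: M_shear.
(* The curve is affine in [t], so its difference quotient is constant for [t] nonzero. *)
- apply: cvg_near_cst; near=> t.
  rewrite addrAC subrr add0r scalerA mulVf ?scale1r //.
  rewrite /cofr fmorph_eq0; near: t; exact: nbhs_dnbhs_neq.
Unshelve. all: by end_near. Qed.

End ShearAlongT.

Theorem theorem7 (R : realType) :
  hol0 (@M R) (@T R) /\
  ~ jet_determination 2 (@M R) /\
  (exists F G : 'rV[Cplx R]_9 -> 'rV[Cplx R]_9,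
     [/\ biholomorphic_germ F /\ sends_to (@M R) (@M R) F,
         biholomorphic_germ G /\ sends_to (@M R) (@M R) G,
         same_jet 2 F G
       & ~ same_germ F G]).
Proof.
have F_M : sends_to (@M R) (@M R) (id + @T R).
  by near=> p => /(M_shear (rmorph1 _)); rewrite scale1r.
have G_M : sends_to (@M R) (@M R) id by near=> p.
have FG := same_jet_addr poly_map_id (@T_vanish R).
have bF := shear_biholomorphic R; have bG := id_biholomorphic R.
split; first exact: T_hol0.
split; first by move=> /(_ _ _ bF F_M bG G_M FG); exact: shear_neq_id.
by exists (id + @T R), id; split=> //; exact: shear_neq_id.
Unshelve. all: by end_near. Qed.
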